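(* Let $\xi$ be a mixture that is not of the form $\xi(x)=cx^2$, and let $I$ and $S$ be the functions associated with $\xi$ as defined in the context. Then for all $x\in\mathbb{R}$, $$I(x)\ge 0\ \Longrightarrow\ \sup_{\alpha\in[0,1]}S(x,\alpha)=S(x,0)=2I(x).$$
   Context: A mixture is a power series $\xi(x)=\sum_{p\ge 0}a_px^p$ with $a_p\ge 0$ for all $p$, $a_0=a_1=0$, not identically zero, with radius of convergence greater than $1$. Write $\xi'=\xi'(1)$, $\xi''=\xi''(1)$, $\xi'_\alpha=\xi'(\alpha)$, $\xi''_\alpha=\xi''(\alpha)$. Define $$I(x)=\frac12\ln\left(\frac{\xi''}{\xi'}\right)-\frac{x^2}{4\xi''}\,\frac{\xi''-\xi'}{\xi''+\xi'}+\Omega\left(\frac{x}{\sqrt{2\xi''}}\right),$$ where $$\Omega(y)=-\tfrac12y\sqrt{y^2-2}+\ln\left(\frac{y+\sqrt{y^2-2}}{\sqrt2}\right)\ \text{ for } y\ge\sqrt2,\qquad \Omega(y)=-\infty\ \text{ for } y<\sqrt2 .$$ For $\alpha\in[0,1)$ define $$S(x,\alpha)=\frac12\ln\left(\frac{(1-\alpha^2)(\xi'')^2}{(\xi')^2-(\xi'_\alpha)^2}\right)+\frac{x^2}{2\xi''}Q(\alpha)+2\,\Omega\left(\frac{x}{\sqrt{2\xi''}}\right),$$ $$Q(\alpha)=1-\frac{2\xi''\big(\xi'-\alpha\xi'_\alpha+(1-\alpha^2)\xi''_\alpha\big)}{(\xi')^2-(\xi'_\alpha)^2+(\xi'-\alpha\xi'_\alpha)(\xi''+\xi''_\alpha)+(1-\alpha^2)\xi''\xi''_\alpha},$$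 and let $S(x,1)$ be the value of the continuous extension, $S(x,1)=\lim_{\alpha\nearrow1}S(x,\alpha)$. *)

(* Defs.v *)
From HB Require Import structures.
From mathcomp Require Import all_boot all_order all_algebra.
From mathcomp Require Import all_classical all_reals all_analysis.

Set Implicit Arguments.
Unset Strict Implicit.
Unset Printing Implicit Defensive.

Import Order.TTheory GRing.Theory Num.Theory.
Import numFieldNormedType.Exports.

Local Open Scope classical_set_scope.
Local Open Scope ring_scope.

Section PowerSeries.
Context {R : realType}.
Implicit Types a : R^nat.

Definition psum a : R -> R := fun x => limn (pseries a x).

Definition cvg_radius a : \bar R :=
  ereal_sup [set `|r|%:E | r in [set r : R | cvgn (pseries a r)]].

Definition in_disc a (x : R) : Prop := (`|x|%:E < cvg_radius a)%E.

(* [psum a] carries no information outside the interval of convergence, hence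
   the restriction to [in_disc] here and in [pure_quadratic]. *)
Definition mixture a : Prop :=
  [/\ forall p, 0 <= a p,
      a 0%N = 0,
      a 1%N = 0,
      ~ (forall x, in_disc a x -> psum a x = 0) &
      (1%:E < cvg_radius a)%E].

Definition pure_quadratic a : Prop :=
  exists c : R, forall x, in_disc a x -> psum a x = c * x ^+ 2.

End PowerSeries.

Section Complexity.
Context {R : realType}.

Definition Omega (y : R) : \bar R :=
  if Num.sqrt 2 <= y then
    (- (1 / 2 * y * Num.sqrt (y ^+ 2 - 2))
     + ln ((y + Num.sqrt (y ^+ 2 - 2)) / Num.sqrt 2))%:E
  else -oo%E.

Variable xi : R -> R.

Definition Ifun (x : R) : \bar R :=
  let d1 := derive1 xi 1 in
  let d2 := derive1n 2 xi 1 in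
  ((1 / 2 * ln (d2 / d1)
    - x ^+ 2 / (4 * d2) * ((d2 - d1) / (d2 + d1)))%:E
   + Omega (x / Num.sqrt (2 * d2)))%E.

Definition Qfun (al : R) : R :=
  let d1 := derive1 xi 1 in
  let d2 := derive1n 2 xi 1 in
  let d1a := derive1 xi al in
  let d2a := derive1n 2 xi al in
  1 - (2 * d2 * (d1 - al * d1a + (1 - al ^+ 2) * d2a))
      / (d1 ^+ 2 - d1a ^+ 2 + (d1 - al * d1a) * (d2 + d2a)
         + (1 - al ^+ 2) * d2 * d2a).

(* The closed formula for S, meaningful for 0 <= al < 1; at al = 1 it
   degenerates to 0 / 0. *)
Definition Sfun_lt1 (x al : R) : \bar R :=
  let d1 := derive1 xi 1 in
  let d2 := derive1n 2 xi 1 in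
  let d1a := derive1 xi al in
  ((1 / 2 * ln ((1 - al ^+ 2) * d2 ^+ 2 / (d1 ^+ 2 - d1a ^+ 2))
    + x ^+ 2 / (2 * d2) * Qfun al)%:E
   + 2%:E * Omega (x / Num.sqrt (2 * d2)))%E.

Definition Sfun (x al : R) : \bar R :=
  if al == 1 then lim (Sfun_lt1 x b @[b --> 1^'-]) else Sfun_lt1 x al.

End Complexity.

(* Main.v *)
(* Write d1 = xi'(1), r = xi''(1) / d1, s = xi'(al) / d1, t = xi''(al) / d1 and
   Y = x^2 / (2 xi''(1)). Since Omega <= 0, the hypothesis I(x) >= 0 gives
   Y (r - 1) <= (r + 1) ln r, while
     Q(al) - Q(0) = 2 r (al - s) (s + al t) / ((r + 1) D),
   D being the denominator of Q over d1^2. So S(x, al) <= S(x, 0) amounts to a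
   lower bound on ln w, w = (1 - s^2) / (1 - al^2). As 1 <= w <= r and
   u / sinh u decreases, ln w / ln r is at least
   (w^(1/2) - w^(-1/2)) / (r^(1/2) - r^(-1/2)), and AM-GM reduces the claim to
     1 - s^2 + (1 + al s) (r - t) - r t (1 - al^2) >= 0.
   This is quadratic in the coefficients of xi', so it is a double sum over
   pairs of monomials; each pair contributes a nonnegative amount because the
   mean of the convex sequence al^i over a centred window is at most its mean
   over the whole range. *)
Require Import Defs.
From HB Require Import structures.
From mathcomp Require Import all_boot all_order all_algebra.
From mathcomp Require Import all_classical all_reals all_analysis.
From mathcomp Require Import zify ring lra.

Set Implicit Arguments.
Unset Strict Implicit.
Unset Printing Implicit Defensive.

Import Order.TTheory GRing.Theory Num.Theory.
Import numFieldNormedType.Exports.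

Local Open Scope classical_set_scope.
Local Open Scope ring_scope.

(** * Elementary inequalities between powers on [0, 1] *)

Lemma bernoulli_ge (R : realDomainType) (z : R) n :
  0 <= z -> 1 + n%:R * (z - 1) <= z ^+ n.
Proof.
move=> z0; elim: n => [|n IH]; first by rewrite mul0r addr0 expr0.
rewrite exprS -natr1; apply: le_trans (ler_wpM2l z0 IH).
have n0 : 0 <= n%:R :> R by [].
by have := sqr_ge0 (z - 1); nra.
Qed.

(** Up to the factor [1 - z], a comparison of the means of [z, ..., z ^+ m] and [1, ..., z ^+ m.+1].
    If [f m] is right minus left, then [f m.+1 = z * f m + (1 - z) * e], with [e] the gap in
    Bernoulli's inequality at exponent [m.+2]. *)
Lemma window_step (R : realDomainType) (z : R) m : 0 <= z <= 1 ->
  m.+2%:R * (z * (1 - z ^+ m)) <= m%:R * (1 - z ^+ m.+2).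
Proof.
move=> /andP[z0 z1]; elim: m => [|m IH].
  by rewrite expr0 subrr mulr0 !mul0r mulr0.
have B := bernoulli_ge m.+2 z0.
have n0 : 0 <= m%:R :> R by [].
move: IH B; rewrite !exprS -!natr1; set u := z ^+ m => IH B.
have := ler_wpM2l z0 IH.
have : 0 <= 1 - z by rewrite subr_ge0.
by move=> /ler_wpM2l /(_ _ _ B); nra.
Qed.

(* The mean of the convex sequence [z ^+ i] over a centred window of length [m]
   is at most its mean over the full range of length [m + 2 * c]. *)
Lemma window_mean (R : realDomainType) (z : R) m c : 0 <= z <= 1 ->
  (m + c.*2)%:R * (z ^+ c * (1 - z ^+ m)) <= m%:R * (1 - z ^+ (m + c.*2)).
Proof.
move=> z01; elim: c m => [|c IH] [|m].
- by rewrite !expr0 subrr !(mulr0, mul0r).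
- by rewrite addn0 expr0 mul1r.
- by rewrite expr0 subrr !(mulr0, mul0r).
have /andP[z0 _] := z01.
have W := window_step m.+1 z01; have {IH} := IH m.+3.
have -> : (m.+3 + c.*2 = m.+1 + c.+1.*2)%N by rewrite doubleS !addnS !addSn.
set n := (m.+1 + _)%N => IH.
(* [W] compares the windows of lengths [m.+1] and [m.+3], [IH] the latter with the full range;
   chaining them leaves the intermediate length as a factor. *)
rewrite -(@ler_pM2l _ m.+3%:R)//.
have K : 0 <= n%:R * z ^+ c by rewrite mulr_ge0 ?exprn_ge0.
have := ler_wpM2l K W; have := ler_wpM2l (ler0n R m.+1) IH.
rewrite (exprS z c); set zc := z ^+ c; set zn := z ^+ n; nra.
Qed.

(** If [d < 2 * j], the exponents from [d] to [2 * j - 1] form a window centred in the first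
    [2 * j + d] exponents, and [(j + d + 1) * (2 * j - d) <= (j + 1) * (2 * j + d)] concludes.
    Otherwise the left side is nonpositive. *)
Lemma window_cross (R : realFieldType) (z : R) j d : 0 <= z <= 1 ->
  (j + d).+1%:R * (z ^+ d - z ^+ j.*2) <= j.+1%:R * (1 - z ^+ (j.*2 + d)).
Proof.
move=> z01; have /andP[z0 z1] := z01.
have zn : 0 <= 1 - z ^+ (j.*2 + d) by rewrite subr_ge0 exprn_ile1.
have [jd|dj] := leqP j.*2 d.
  apply: (@le_trans _ _ 0); last by rewrite mulr_ge0.
  by rewrite mulr_ge0_le0// subr_le0 ler_wiXn2l.
have n0 : 0 < (j.*2 + d)%:R :> R by rewrite ltr0n addn_gt0 (leq_ltn_trans _ dj).
rewrite -(ler_pM2l n0).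
pose m := (j.*2 - d)%N; have jE : j.*2 = (m + d)%N by rewrite subnK// ltnW.
have := window_mean m d z01; rewrite -addnn addnA -jE => W.
have -> : z ^+ d - z ^+ j.*2 = z ^+ d * (1 - z ^+ m).
  by rewrite jE exprD mulrBr mulr1 mulrC.
rewrite mulrCA; apply: le_trans (ler_wpM2l (ler0n R _) W) _.
rewrite !mulrA ler_wpM2r// -!natrM ler_nat.
have : (j + j = m + d)%N by rewrite addnn.
nia.
Qed.

(* Normalised by [z ^+ j.+1] and with [z = exp (- 2 * v)], this reads
   (n + 2) sinh (n v) >= j (k+1) sinh ((k-j+2) v) + k (j+1) sinh ((j-k+2) v)
   for the exponents j+1, j+1+d and n their sum. *)
Lemma monomial_pair_le_ge0 (R : realFieldType) (z : R) i d : 0 <= z <= 1 ->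
  0 <= (i.+2 + (i + d).+2)%:R * (1 - z ^+ (i.+1 + (i + d).+1))
     - i.+1%:R * (i + d).+2%:R * (z ^+ i - z ^+ (i + d).+2)
     - (i + d).+1%:R * i.+2%:R * (z ^+ (i + d) - z ^+ i.+2).
Proof.
move=> z01; have /andP[z0 z1] := z01.
have i0 : 0 <= i%:R :> R by [].
have EE : i.*2%:R = i%:R * 2 :> R by rewrite -muln2 natrM.
set A := z ^+ i.
(* From gap 2 on the argument relies on [le2], which may fail for smaller gaps. Gap 0 is a multiple
   of the window of length 2; gap 1 combines the windows of lengths 3 and 1. *)
case: d => [|[|d]].
- have W := window_mean 2 i z01.
  rewrite addn0 addSn addnS addnn.
  rewrite -/A add2n -natr1 -natr1 -muln2 natrM muln2 in W.
  rewrite -!natr1 !exprS -/A.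
  set B := z ^+ i.*2; rewrite !exprS expr0 -/B in W.
  rewrite [leRHS](_ : _ = (i%:R + 2) * (2 * (1 - z * (z * B))
      - (i%:R * 2 + 1 + 1) * (A * (1 - z * (z * 1))))).
    by apply: mulr_ge0; [lra|]; rewrite subr_ge0.
  by rewrite !EE; ring.
- have W3 := window_mean 3 i z01; have W1 := window_mean 1 i.+1 z01.
  rewrite addSn addnS addn1 addnS addnn.
  rewrite -/A !addSn add0n -!natr1 -muln2 natrM muln2 in W3.
  rewrite doubleS add1n expr1 exprS -/A -!natr1 -muln2 natrM muln2 in W1.
  rewrite -!natr1 !exprS -/A.
  set B := z ^+ i.*2; rewrite !exprS expr0 -/B in W3; rewrite !exprS -/B in W1.
  rewrite -(@pmulr_rge0 _ (2 * i%:R + 3)); last by lra.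
  rewrite [leRHS](_ : _ =
     (i%:R + 1) * (i%:R + 3) * (3 * (1 - z * (z * (z * B)))
        - (i%:R * 2 + 1 + 1 + 1) * (A * (1 - z * (z * (z * 1)))))
     + (i%:R + 2) ^+ 2 * (1 * (1 - z * (z * (z * B)))
        - (i%:R * 2 + 1 + 1 + 1) * (z * A * (1 - z)))
     + 2 * (1 - z * (z * (z * B)))); last first.
    by rewrite !EE; ring.
  have B1 : z * (z * (z * B)) <= 1 by rewrite /B -!exprS exprn_ile1.
  by apply: addr_ge0; [apply: addr_ge0; apply: mulr_ge0|]; rewrite ?sqr_ge0//; nra.
have W2 := window_mean 2 i z01.
have WX := window_cross i.+1 d.+2 z01.
set j := i.+1 in WX *; set e := d.+2 in WX *.
have -> : (i + e).+1 = (j + e)%N by [].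
rewrite -/A add2n -doubleS -/j expr2 in W2.
have jj : (2 * j%:R) * (A * (1 - z * z)) <= 2 * (1 - z ^+ j.*2).
  by rewrite -natrM mul2n.
have -> : (i.+2 + (i + e).+2 = (j + (j + e)).+2)%N by rewrite /j addSn addnS !addSn.
have -> : (j + (j + e) = j.*2 + e)%N by rewrite addnA addnn.
have ze1 : z ^+ e <= 1 by rewrite exprn_ile1.
have ze0 : 0 <= z ^+ e by rewrite exprn_ge0.
have EA : z ^+ (i + e) = A * z ^+ e by rewrite exprD.
have E2 : z ^+ i.+2 = A * (z * z) by rewrite !exprS -/A; ring.
have E3 : z ^+ (i + e).+2 = A * (z * z) * z ^+ e by rewrite (exprS z (i + e).+1) (exprS z (i + e)) EA; ring.
have En : z ^+ (j.*2 + e) = z ^+ j.*2 * z ^+ e by rewrite exprD.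
have le2 : z ^+ (i + e) <= z ^+ i.+2.
  by rewrite ler_wiXn2l// /e !addnS !ltnS leq_addr.
have j0 : 0 <= i%:R :> R by [].
have e0 : 0 <= e%:R :> R by [].
move: WX jj le2; rewrite E3 E2 EA En.
rewrite -!natr1 !natrD.
rewrite EE; set I := i%:R in j0 *; set K := e%:R in e0 *.
set V := z ^+ j.*2; set Z := z ^+ e in ze0 ze1 * => WX jj le2.
(* The three summands are nonnegative by [jj], [WX] and [le2], in this order. *)
rewrite [leRHS](_ : _ =
    (I + K + 2) * (1 + Z) * ((1 - V) - (I + 1) * (A * (1 - z * z)))
    + ((I + 2) * (1 - V * Z) - (I + K + 2) * (Z - V))
    + K * (A * (z * z) - A * Z)); last by ring.
apply: addr_ge0; last by rewrite mulr_ge0 ?subr_ge0.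
apply: addr_ge0; last by lra.
by apply: mulr_ge0; [apply: mulr_ge0|]; lra.
Qed.

Lemma monomial_pair_ge0 (R : realFieldType) (z : R) j k : 0 <= z <= 1 ->
  0 <= (j.+2 + k.+2)%:R * (1 - z ^+ (j.+1 + k.+1))
     - j.+1%:R * k.+2%:R * (z ^+ j - z ^+ k.+2)
     - k.+1%:R * j.+2%:R * (z ^+ k - z ^+ j.+2).
Proof.
move=> z01; have [jk|/ltnW kj] := leqP j k.
  by rewrite -(subnKC jk) monomial_pair_le_ge0.
have := monomial_pair_le_ge0 k (j - k) z01; rewrite subnKC//.
by rewrite addrAC [(k.+2 + _)%N]addnC [(k.+1 + _)%N]addnC.
Qed.

(** * Quadratic inequalities for truncated power series *)

Lemma sum_pair_ge0 (R : realFieldType) N (F : 'I_N -> 'I_N -> R) :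
  (forall j k, 0 <= F j k + F k j) -> 0 <= \sum_j \sum_k F j k.
Proof.
move=> F0; rewrite -(@pmulr_rge0 _ 2)// mulr_natl mulr2n.
rewrite {2}exchange_big -big_split; apply: sumr_ge0 => j _.
by rewrite -big_split; apply: sumr_ge0 => k _; exact: F0.
Qed.

(** For [b] the coefficients of [xi'], the sums [d], [s], [r], [t] truncate [xi'(1)], [xi'(z)],
    [xi''(1)], [xi''(z)]. The symmetrised coefficient of [b j * b k] is the quantity in
    [monomial_pair_ge0], which concerns positive exponents; [b 0 = 0] disposes of the others. *)
Lemma psum_slope_ge0 (R : realFieldType) (b : nat -> R) (z : R) N
    (d := \sum_(k < N) b k) (s := \sum_(k < N) b k * z ^+ k)
    (r := \sum_(k < N) k%:R * b k) (t := \sum_(k < N) k%:R * b k * z ^+ k.-1) :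
  (forall k, 0 <= b k) -> b 0%N = 0 -> 0 <= z <= 1 ->
  0 <= d ^+ 2 - s ^+ 2 + (d + z * s) * (r - t) - r * t * (1 - z ^+ 2).
Proof.
move=> b0 b00 z01.
pose F (j k : nat) := b j * b k * (1 - z ^+ j * z ^+ k
   + (1 + z * z ^+ k) * (j%:R - j%:R * z ^+ j.-1)
   - j%:R * k%:R * z ^+ k.-1 * (1 - z ^+ 2)).
rewrite [leRHS](_ : _ = \sum_(j < N) \sum_(k < N) F j k).
  apply: sum_pair_ge0 => j k; rewrite /F.
  case: (j : nat) => [|{}j]; first by rewrite b00 !(mul0r, mulr0) addr0.
  case: (k : nat) => [|{}k]; first by rewrite b00 !(mul0r, mulr0) addr0.
  rewrite [b k.+1 * _]mulrC -mulrDr mulr_ge0 ?mulr_ge0//.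
  have := monomial_pair_ge0 j k z01.
  rewrite [z ^+ (j.+1 + _)]exprD [(j.+2 + _)%:R]natrD -!natr1 !exprS /=.
  by congr (0 <= _); ring.
rewrite (_ : _ - _ = d * d - s * s + (r * d + r * (z * s) - t * d - t * (z * s))
  - r * (t * (1 - z ^+ 2))); last by ring.
have -> : z * s = \sum_(k < N) z * (b k * z ^+ k) by rewrite mulr_sumr.
rewrite [t * (1 - _)]mulr_suml /d /s /r /t !big_distrlr /=.
rewrite -!sumrN -!big_split; apply: eq_bigr => j _ /=.
rewrite -!sumrN -!big_split; apply: eq_bigr => k _ /=.
by rewrite /F; ring.
Qed.

(** Divided by [d ^+ 2], this becomes the upper bound [w <= r] on the ratio [w] of
    [overlap_log_bound]. *)
Lemma psum_chord_le (R : realFieldType) (b : nat -> R) (z : R) N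
    (d := \sum_(k < N) b k) (s := \sum_(k < N) b k * z ^+ k)
    (r := \sum_(k < N) k%:R * b k) :
  (forall k, 0 <= b k) -> b 0%N = 0 -> 0 <= z <= 1 ->
  d ^+ 2 - s ^+ 2 <= r * d * (1 - z ^+ 2).
Proof.
move=> b0 b00 z01; have /andP[z0 z1] := z01.
pose F (j k : nat) := b j * b k * (j%:R * (1 - z ^+ 2) - 1 + z ^+ j * z ^+ k).
rewrite -subr_ge0 [leRHS](_ : _ = \sum_(j < N) \sum_(k < N) F j k).
  apply: sum_pair_ge0 => j k; rewrite /F.
  case: (j : nat) => [|{}j]; first by rewrite b00 !(mul0r, mulr0) addr0.
  case: (k : nat) => [|{}k]; first by rewrite b00 !(mul0r, mulr0) addr0.
  rewrite [b k.+1 * _]mulrC -mulrDr mulr_ge0 ?mulr_ge0//.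
  (* Tangent at [u = 1] to the convex function [u ^ (n / 2)], where [u = z ^+ 2] and [n >= 2] is the
     total exponent. *)
  suff : 2 * (1 - z ^+ (j + k).+2) <= (j + k).+2%:R * (1 - z ^+ 2).
    rewrite [z ^+ k.+1 * _]mulrC -exprD addSn addnS -!natr1 natrD; lra.
  elim: (j + k)%N => [//|n IH].
  have zn : z ^+ n.+2 <= z by rewrite exprS ler_piMr// exprn_ile1.
  move: zn IH; rewrite -[n.+3%:R]natr1 (exprS _ n.+2).
  set P := z ^+ n.+2 => zn IH.
  have : 0 <= 1 - z by rewrite subr_ge0.
  move=> /ler_wpM2r /(_ _ _ zn); rewrite expr2 in IH *.
  by have := sqr_ge0 (1 - z); lra.
rewrite (_ : _ - _ = r * d * (1 - z ^+ 2) - d * d + s * s); last by ring.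
rewrite -mulrA [d * (1 - _)]mulr_suml /d /s /r !big_distrlr /=.
rewrite -!sumrN -!big_split; apply: eq_bigr => j _ /=.
rewrite -!sumrN -!big_split; apply: eq_bigr => k _ /=.
by rewrite /F; ring.
Qed.

(** * Hyperbolic sine and logarithm inequalities *)

Lemma is_derive_ge0_le (R : realType) (f df : R -> R) (a b : R) : a <= b ->
  (forall x, a <= x -> is_derive x 1 f (df x)) -> (forall x, a <= x -> 0 <= df x) ->
  f a <= f b.
Proof.
move=> ab fdf df0.
apply: (@ger0_derive1_ndecry _ f a) => //.
- move=> x; rewrite in_itv/= andbT => /ltW ax.
  by have [] := fdf _ ax.
- move=> x; rewrite in_itv/= andbT => /ltW ax.
  by rewrite derive1E; have [_ ->] := fdf _ ax; exact: df0.
- apply: derivable_within_continuous => x; rewrite in_itv/= andbT => ax.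
  by have [] := fdf _ ax.
Qed.

(** Convexity of [sinh] on the nonnegative axis: [df] is [2 * th * (cosh u - cosh (th * u))],
    factored so that its sign is visible. *)
Lemma expR_subN_scale (R : realType) (th v : R) : 0 <= th <= 1 -> 0 <= v ->
  expR (th * v) - expR (- (th * v)) <= th * (expR v - expR (- v)).
Proof.
move=> /andP[th0 th1] v0.
pose f (u : R) := th * (expR u - expR (- u)) - (expR (th * u) - expR (- (th * u))).
pose df (u : R) := th * ((expR u - expR (th * u)) * (1 - (expR u * expR (th * u))^-1)).
suff : f 0 <= f v.
  by rewrite /f !mulr0 oppr0 subrr mulr0 subr0 subr_ge0.
apply: (@is_derive_ge0_le _ _ df) => // u u0.
  rewrite /f; apply: is_derive_eq.
  have e1 := expR_gt0 u; have e2 := expR_gt0 (th * u).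
  rewrite /df !expRN /GRing.scale /=; field.
  by rewrite !gt_eqF.
rewrite /df; apply: mulr_ge0 => //; apply: mulr_ge0.
  by rewrite subr_ge0 ler_expR ler_piMl.
by rewrite subr_ge0 -expRD -expRN expR_le1 oppr_le0 addr_ge0 ?mulr_ge0.
Qed.

Lemma ln_le_subV (R : realType) (u : R) : 1 <= u -> 2 * ln u <= u - u^-1.
Proof.
move=> u1.
pose f (u : R) := u - u^-1 - 2 * ln u.
pose df (u : R) := (1 - u^-1) ^+ 2.
suff : f 1 <= f u by rewrite /f ln1 mulr0 invr1 subrr subr0 subr_ge0.
apply: (@is_derive_ge0_le _ _ df) => // w w1; last exact: sqr_ge0.
have w0 : 0 < w by apply: lt_le_trans w1.
have wn : w != 0 by rewrite gt_eqF.
have dln := is_derive1_ln w0.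
have dV : is_derive w 1 (fun u : R => u^-1) (- w ^- 2 *: 1) by exact: is_deriveV.
rewrite /f; apply: is_derive_eq.
by rewrite /df /GRing.scale /=; field.
Qed.

(** Monotonicity of [sinh u / u] between [ln z] and [ln y], from [expR_subN_scale] with
    [th = ln z / ln y]; [ln y = 0] is treated apart. *)
Lemma ln_subV_le (R : realType) (z y : R) : 1 <= z -> z <= y ->
  (z - z^-1) * ln y <= ln z * (y - y^-1).
Proof.
move=> z1 zy; have y1 : 1 <= y by exact: le_trans zy.
have z0 : 0 < z by exact: lt_le_trans z1.
have y0 : 0 < y by exact: lt_le_trans y1.
have lz : 0 <= ln z by exact: ln_ge0.
have ly : ln z <= ln y by rewrite ler_ln ?posrE.
have [ly0|ly0] := leP (ln y) 0.
  have -> : ln y = 0 by apply/eqP; rewrite eq_le ly0 (le_trans lz).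
  by rewrite mulr0 mulr_ge0// subr_ge0 (le_trans _ y1)// invf_le1.
have := @expR_subN_scale _ (ln z / ln y) (ln y).
rewrite divfK ?gt_eqF// divr_ge0 ?(ltW ly0)//= ler_pdivrMr// mul1r => /(_ ly isT).
rewrite !expRN !lnK ?posrE// => H.
by rewrite -ler_pdivlMr// mulrAC.
Qed.

(** * Sign of [Omega] and the logarithmic bound at fixed overlap *)

(** With [q = sqrt (y ^+ 2 - 2)], the inverse of [z = (y + q) / sqrt 2] is [(y - q) / sqrt 2]. Hence
    [z ^+ 2 - z ^- 2 = 2 * y * q], and [ln_le_subV] at [z ^+ 2] gives the claim. *)
Lemma Omega_le0 (R : realType) (y : R) : (Omega y <= 0)%E.
Proof.
rewrite /Omega; case: ifPn => [y2|_]; last exact: leNye.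
rewrite lee_fin.
have s0 : 0 < Num.sqrt 2 :> R by rewrite sqrtr_gt0.
have s2 : Num.sqrt 2 ^+ 2 = 2 :> R by rewrite sqr_sqrtr.
have y0 : 0 < y by exact: lt_le_trans y2.
have q2 : Num.sqrt (y ^+ 2 - 2) ^+ 2 = y ^+ 2 - 2.
  by rewrite sqr_sqrtr// subr_ge0 -s2 lerXn2r// nnegrE ltW.
have q0 := sqrtr_ge0 (y ^+ 2 - 2).
set q := Num.sqrt (y ^+ 2 - 2) in q0 q2 *; set s := Num.sqrt 2 in s0 s2 y2 *.
pose z := (y + q) / s.
have z1 : 1 <= z by rewrite ler_pdivlMr// mul1r; lra.
have z0 : 0 < z by exact: lt_le_trans z1.
have zV : z^-1 = (y - q) / s.
  apply: (mulfI (lt0r_neq0 z0)); rewrite mulfV ?lt0r_neq0// /z.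
  rewrite mulrACA [(y + q) * _]mulrC -subr_sqr q2 -invfM -expr2 s2; lra.
have L : 2 * ln (z ^+ 2) <= z ^+ 2 - (z ^+ 2)^-1 by rewrite ln_le_subV// exprn_ege1.
rewrite (lnXn 2 z0) -exprVn subr_sqr zV in L.
have E1 : z - (y - q) / s = 2 * q / s by rewrite /z; field; rewrite gt_eqF.
have E2 : z + (y - q) / s = 2 * y / s by rewrite /z; field; rewrite gt_eqF.
rewrite E1 E2 mulrACA -invfM -expr2 s2 in L.
rewrite -/z; lra.
Qed.

(* With [w := (1 - s ^+ 2) / (1 - al ^+ 2)] in [[1, r]], [ln_subV_le] bounds
   [ln w] below by [ln r * (w - 1) / sqrt w * sqrt r / (r - 1)]; AM-GM on
   [sqrt (r * w)] then leaves the hypothesis [slope]. *)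
Lemma overlap_log_bound (R : realType) (al s t r Y : R)
    (D := 1 - s ^+ 2 + (1 - al * s) * (r + t) + (1 - al ^+ 2) * r * t) :
  0 <= al < 1 -> 0 <= s <= al -> 0 <= t -> 1 < r -> 0 <= Y ->
  1 - s ^+ 2 <= r * (1 - al ^+ 2) ->
  0 <= 1 - s ^+ 2 + (1 + al * s) * (r - t) - r * t * (1 - al ^+ 2) ->
  Y * (r - 1) <= ln r * (r + 1) ->
  Y * (2 * r * ((al - s) * (s + al * t)) / ((r + 1) * D)) <=
    1 / 2 * ln ((1 - s ^+ 2) / (1 - al ^+ 2)).
Proof.
move=> /andP[al0 al1] /andP[s0 sal] t0 r1 Y0 chord slope YB.
have a2 : 0 < 1 - al ^+ 2 by nra.
have s2 : 0 < 1 - s ^+ 2 by nra.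
have as1 : 0 < 1 - al * s by nra.
have as2 : al ^+ 2 - s ^+ 2 = (al - s) * (al + s) by rewrite subr_sqr.
have r0 : 0 < r by lra.
have D0 : 0 < D.
  have rt : 0 <= r + t by lra.
  have := mulr_ge0 (ltW as1) rt; have := mulr_ge0 (mulr_ge0 (ltW a2) (ltW r0)) t0.
  by rewrite /D; lra.
set w := _ / (1 - al ^+ 2).
have w1 : 1 <= w.
  by rewrite /w ler_pdivlMr// mul1r lerB// lerXn2r// nnegrE.
have wr : w <= r by rewrite /w ler_pdivrMr.
have w0 : 0 < w by exact: lt_le_trans w1.
pose p := Num.sqrt w; pose q := Num.sqrt r.
have p2 : p ^+ 2 = w by rewrite sqr_sqrtr// ltW.
have q2 : q ^+ 2 = r by rewrite sqr_sqrtr// ltW.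
have p1 : 1 <= p by rewrite -[leLHS]sqrtr1 ler_wsqrtr.
have pq : p <= q by rewrite ler_wsqrtr.
have p0 : 0 < p by exact: lt_le_trans p1.
have q0 : 0 < q by exact: lt_le_trans pq.
have L := ln_subV_le p1 pq.
have lw : ln w = 2 * ln p by rewrite -p2 lnXn// mulr_natl.
have lr : ln r = 2 * ln q by rewrite -q2 lnXn// mulr_natl.
have r10 : 0 < r - 1 by lra.
have L2 : (w - 1) * q * ln r <= ln w * p * (r - 1).
  have := ler_wpM2r (ltW (mulr_gt0 p0 q0)) L.
  rewrite lw lr -p2 -q2 [leLHS](_ : _ = (p ^+ 2 - 1) * q * ln q); last first.
    by field; rewrite gt_eqF.
  rewrite [leRHS](_ : _ = ln p * p * (q ^+ 2 - 1)); last by field; rewrite gt_eqF.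
  lra.
have wE : w * (1 - al ^+ 2) = 1 - s ^+ 2 by rewrite divfK ?gt_eqF.
have w1E : (w - 1) * (1 - al ^+ 2) = (al - s) * (al + s).
  by rewrite mulrBl wE mul1r -as2; ring.
have pqw : 2 * (p * q) <= w + r by rewrite -p2 -q2; have := sqr_ge0 (p - q); lra.
(* The difference of the two sides is [al - s] times the quantity in [slope]. *)
have SL : 2 * (s + al * t) * ((w + r) * (1 - al ^+ 2)) <= (al + s) * D.
  rewrite [(w + r) * _]mulrDl wE -subr_ge0 [leRHS](_ : _ = (al - s) *
    (1 - s ^+ 2 + (1 + al * s) * (r - t) - r * t * (1 - al ^+ 2))).
    by apply: mulr_ge0; rewrite ?slope ?subr_ge0.
  by rewrite /D; ring.
have key : 4 * (s + al * t) * (p * q) * (1 - al ^+ 2) <= (al + s) * D.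
  apply: le_trans SL; rewrite [leRHS]mulrA ler_wpM2r ?(ltW a2)//.
  have st0 : 0 <= s + al * t by rewrite addr_ge0 ?mulr_ge0.
  by have := ler_wpM2l st0 pqw; lra.
have key2 : 4 * (al - s) * (s + al * t) * (p * q) <= (w - 1) * D.
  rewrite -(ler_pM2r a2) [leRHS]mulrAC w1E.
  have as0 : 0 <= al - s by rewrite subr_ge0.
  by have := ler_wpM2l as0 key; lra.
have lnw0 : 0 <= ln w by exact: ln_ge0.
have r11 : 0 < r + 1 by lra.
rewrite mulrA ler_pdivrMr ?mulr_gt0//.
set X := (al - s) * (s + al * t).
have X0 : 0 <= X by rewrite mulr_ge0 ?subr_ge0// addr_ge0 ?mulr_ge0.
have prq : 0 < p * (r - 1) by rewrite mulr_gt0.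
rewrite -(ler_pM2r prq).
have key3 : 4 * X * (p * q) <= (w - 1) * D by move: key2; rewrite /X !mulrA.
clearbody X D.
(* With denominators cleared, [YB] trades [Y] for [ln r]; then [key3] and [L2] trade [ln r] for
   [ln w]. *)
apply: (@le_trans _ _ (2 * r * X * p * (ln r * (r + 1)))).
  have C : 0 <= 2 * r * X * p by rewrite !mulr_ge0 ?(ltW r0) ?(ltW p0).
  by have := ler_wpM2l C YB; lra.
have lr0 : 0 <= ln r by rewrite ln_ge0// ltW.
have C : 0 <= q * (ln r * (r + 1)) / 2 by rewrite !mulr_ge0 ?invr_ge0 ?(ltW q0) ?(ltW r11) ?(ltW D0).
have K3 := ler_wpM2l C key3.
have C' : 0 <= D * (r + 1) / 2 by rewrite !mulr_ge0 ?invr_ge0 ?(ltW q0) ?(ltW r11) ?(ltW D0).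
have K4 := ler_wpM2l C' L2.
have K3' : q * (ln r * (r + 1)) / 2 * (4 * X * (p * q)) = 2 * r * X * p * (ln r * (r + 1)).
  by rewrite -q2; field.
rewrite K3' in K3; apply: (le_trans K3); lra.
Qed.

(** * Termwise differentiation of power series with nonnegative coefficients *)

(** By convexity the power lies above its tangent at [z]. This dominates the differentiated series
    at [z] by the series at [K]. *)
Lemma exprn_slope_le (R : realDomainType) (z K : R) n : 0 <= z <= K ->
  n%:R * z ^+ n.-1 * (K - z) <= K ^+ n.
Proof.
move=> /andP[z0 zK]; have K0 := le_trans z0 zK.
elim: n => [|[|n] IH]; first by rewrite !mul0r expr0.
  by rewrite expr0 expr1 !mul1r gerBl.
have := ler_wpM2l z0 IH; have := lerXn2r n.+1 z0 K0 zK.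
rewrite -[n.+2%:R]natr1 /= (exprS K n.+1) (exprS z n) => zn.
have Kz : 0 <= K - z by rewrite subr_ge0.
by have := ler_wpM2r Kz zn; lra.
Qed.

Lemma is_cvg_pseries_diffs (R : realType) (c : R^nat) (z K : R) :
  (forall k, 0 <= c k) -> cvgn (pseries c K) -> 0 <= z < K ->
  cvgn (pseries (pseries_diffs c) z).
Proof.
move=> c0 cK /andP[z0 zK].
pose u i := i%:R * c i * z ^+ i.-1.
have -> : pseries (pseries_diffs c) z = (fun n => series u n.+1).
  apply/funext => n; rewrite /pseries /series /= big_nat_recl//= /u.
  by rewrite !mul0r add0r.
suff cu : cvgn (series u).
  by apply/cvg_ex; exists (limn (series u)); rewrite (cvg_shiftS (series u)).
have Kz : 0 < K - z by rewrite subr_gt0.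
apply: (@series_le_cvg _ _ (fun k => (K - z)^-1 * (c k * K ^+ k))).
- by move=> n; rewrite /u !mulr_ge0// exprn_ge0.
- by move=> n; rewrite !mulr_ge0// ?invr_ge0 ?(ltW Kz)// exprn_ge0// (le_trans z0)// ltW.
- move=> n; rewrite mulrC ler_pdivlMr// /u.
  rewrite [leLHS](_ : _ = c n * (n%:R * z ^+ n.-1 * (K - z))); last by ring.
  by rewrite ler_wpM2l// exprn_slope_le// z0 ltW.
- exact: (@is_cvg_seriesZ _ (fun k => c k * K ^+ k)).
Qed.

Lemma is_derive_psum (R : realType) (c : R^nat) (x K : R) :
  (forall k, 0 <= c k) -> cvgn (pseries c K) -> `|x| < K ->
  is_derive x 1 (psum c) (psum (pseries_diffs c) x).
Proof.
move=> c0 cK xK.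
(* [pseries_snd_diffs] needs the series and its first two derivatives to converge at a point beyond
   [|x|]; each differentiation costs some radius. *)
pose K1 := (`|x| + K) / 2; pose K2 := (`|x| + K1) / 2.
have x0 : 0 <= `|x| by [].
have [xK2 K21 K1K] : [/\ `|x| < K2, K2 < K1 & K1 < K].
  by rewrite /K2 /K1; split; lra.
have cK1 : cvgn (pseries (pseries_diffs c) K1).
  by apply: (is_cvg_pseries_diffs c0 cK); lra.
have d0 k : 0 <= pseries_diffs c k by rewrite mulr_ge0.
have K2K : `|K2| < `|K| by rewrite !ger0_norm; lra.
have K2K1 : `|K2| < `|K1| by rewrite !ger0_norm; lra.
apply: (@pseries_snd_diffs _ c K2).
- exact: is_cvg_pseries_inside cK _.
- exact: is_cvg_pseries_inside cK1 _.
- by apply: (is_cvg_pseries_diffs d0 cK1); lra.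
- by rewrite [`|K2|]ger0_norm; lra.
Qed.

Lemma derive1n2_psum (R : realType) (c : R^nat) (x K : R) :
  (forall k, 0 <= c k) -> cvgn (pseries c K) -> `|x| < K ->
  derive1n 2 (psum c) x = psum (pseries_diffs (pseries_diffs c)) x.
Proof.
move=> c0 cK xK; rewrite derive1nS derive1n1 derive1E.
(* The first derivative is identified only for [|y| < K], so the second one is taken through
   agreement near [x]. *)
rewrite (@near_eq_derive _ _ _ _ (psum (pseries_diffs c))) //.
  pose K1 := (`|x| + K) / 2.
  have [xK1 K1K] : `|x| < K1 /\ K1 < K by rewrite /K1; split; lra.
  have x0 : 0 <= `|x| by [].
  have cK1 : cvgn (pseries (pseries_diffs c) K1).
    by apply: (is_cvg_pseries_diffs c0 cK); lra.
  have d0 k : 0 <= pseries_diffs c k by rewrite mulr_ge0.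
  by have [_ ->] := is_derive_psum d0 cK1 xK1.
have yK : \forall y \near x, `|y| < K.
  exact: (cvgr_lt _ (@norm_continuous _ R x) _ xK).
near=> y.
have yK' : `|y| < K by near: y.
by rewrite derive1E; have [_ ->] := is_derive_psum c0 cK yK'.
Unshelve. all: end_near. Qed.

(** * Comparison of the values at overlap [al] and overlap 0 *)

(** Normalising by [d1] turns the logarithmic term into [ln r - ln w / 2], with [w] as in
    [overlap_log_bound], and [Q] into its value [(1 - r) / (1 + r)] at overlap 0 plus the gain
    bounded there. *)
Lemma complexity_value_le (R : realType) (al d1 d2 d1a d2a Y : R) :
  0 <= al < 1 -> 0 < d1 -> d1 < d2 -> 0 <= d1a <= al * d1 -> 0 <= d2a -> 0 <= Y ->
  d1 ^+ 2 - d1a ^+ 2 <= d2 * d1 * (1 - al ^+ 2) ->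
  0 <= d1 ^+ 2 - d1a ^+ 2 + (d1 + al * d1a) * (d2 - d2a)
       - d2 * d2a * (1 - al ^+ 2) ->
  Y * (d2 - d1) <= ln (d2 / d1) * (d2 + d1) ->
  1 / 2 * ln ((1 - al ^+ 2) * d2 ^+ 2 / (d1 ^+ 2 - d1a ^+ 2))
    + Y * (1 - (2 * d2 * (d1 - al * d1a + (1 - al ^+ 2) * d2a))
      / (d1 ^+ 2 - d1a ^+ 2 + (d1 - al * d1a) * (d2 + d2a)
         + (1 - al ^+ 2) * d2 * d2a)) <=
  ln (d2 / d1) + Y * ((d1 - d2) / (d1 + d2)).
Proof.
move=> al01 d10 d12 /andP[d1a0 d1al] d2a0 Y0 chord slope YB.
have /andP[al0 al1] := al01.
pose s := d1a / d1; pose t := d2a / d1; pose r := d2 / d1.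
have d1n : d1 != 0 by rewrite gt_eqF.
have [Es Et Er] : [/\ d1a = s * d1, d2a = t * d1 & d2 = r * d1].
  by rewrite /s /t /r !divfK.
have s0 : 0 <= s by rewrite divr_ge0// ltW.
have t0 : 0 <= t by rewrite divr_ge0// ltW.
have sal : s <= al by rewrite ler_pdivrMr.
have r1 : 1 < r by rewrite ltr_pdivlMr// mul1r.
have dd : 0 < d1 ^+ 2 by rewrite exprn_gt0.
have chord' : 1 - s ^+ 2 <= r * (1 - al ^+ 2).
  rewrite -(ler_pM2r dd); move: chord; rewrite Es Er; lra.
have slope' : 0 <= 1 - s ^+ 2 + (1 + al * s) * (r - t) - r * t * (1 - al ^+ 2).
  rewrite -(pmulr_lge0 _ dd); move: slope; rewrite Es Er Et; lra.
have YB' : Y * (r - 1) <= ln r * (r + 1).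
  by rewrite -(ler_pM2r d10); move: YB; rewrite -/r Er; lra.
rewrite -/r; clearbody s t r.
have s0al : 0 <= s <= al by rewrite s0.
have := overlap_log_bound al01 s0al t0 r1 Y0 chord' slope' YB'.
have a2 : 0 < 1 - al ^+ 2 by nra.
have s2 : 0 < 1 - s ^+ 2 by nra.
have as1 : 0 < 1 - al * s by nra.
have r0 : 0 < r by lra.
have [a2n s2n] : 1 - al ^+ 2 != 0 /\ 1 - s ^+ 2 != 0 by rewrite !lt0r_neq0.
set D := 1 - s ^+ 2 + _ + _.
have D0 : 0 < D.
  have rt : 0 <= r + t by lra.
  have := mulr_ge0 (ltW as1) rt; have := mulr_ge0 (mulr_ge0 (ltW a2) (ltW r0)) t0.
  by rewrite /D; lra.
have -> : ln ((1 - al ^+ 2) * d2 ^+ 2 / (d1 ^+ 2 - d1a ^+ 2))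
    = 2 * ln r - ln ((1 - s ^+ 2) / (1 - al ^+ 2)).
  rewrite mulr_natl -lnXn// -ln_div ?posrE ?exprn_gt0 ?divr_gt0//.
  have -> : d1 ^+ 2 - d1a ^+ 2 = d1 ^+ 2 * (1 - s ^+ 2) by rewrite Es; ring.
  by rewrite Er; congr ln; field; rewrite d1n a2n s2n.
have -> : (d1 - d2) / (d1 + d2) = (1 - r) / (1 + r).
  by rewrite Er -{1 3}[d1]mul1r -mulrBl -mulrDl -mulf_div divff// mulr1.
have -> : 1 - 2 * d2 * (d1 - al * d1a + (1 - al ^+ 2) * d2a)
      / (d1 ^+ 2 - d1a ^+ 2 + (d1 - al * d1a) * (d2 + d2a)
         + (1 - al ^+ 2) * d2 * d2a)
    = (1 - r) / (1 + r) + 2 * r * ((al - s) * (s + al * t)) / ((r + 1) * D).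
  rewrite (_ : _ + (1 - al ^+ 2) * d2 * d2a = D * d1 ^+ 2); last first.
    by rewrite Es Er Et /D; ring.
  have Dn : D != 0 by rewrite gt_eqF.
  have rn : r + 1 != 0 by rewrite gt_eqF// addr_gt0.
  have rn' : 1 + r != 0 by rewrite addrC.
  rewrite Es Er Et.
  have -> : (1 - r) / (1 + r) + 2 * r * ((al - s) * (s + al * t)) / ((r + 1) * D)
    = ((1 - r) * D + 2 * r * ((al - s) * (s + al * t))) / ((r + 1) * D).
    by field; rewrite Dn rn.
  have -> : 1 - 2 * (r * d1) * (d1 - al * (s * d1) + (1 - al ^+ 2) * (t * d1)) / (D * d1 ^+ 2) = (D - 2 * r * (1 - al * s + (1 - al ^+ 2) * t)) / D.
    by field; rewrite Dn d1n.
  apply/eqP; rewrite eqr_div ?mulf_neq0//; apply/eqP.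
  rewrite /D; ring.
lra.
Qed.

(** * Convergence and coefficients of mixtures *)

Lemma mixture_cvg (R : realType) (a : R^nat) : mixture a ->
  exists2 K : R, 1 < K & cvgn (pseries a K).
Proof.
move=> [_ _ _ _ /ereal_sup_gt[_ [r ar <-]]]; rewrite lte_fin => r1.
(* [r] may be negative; the midpoint of 1 and [|r|] is a positive point of convergence. *)
exists ((1 + `|r|) / 2); first by lra.
by apply: (is_cvg_pseries_inside ar); rewrite ger0_norm; lra.
Qed.

(** If all coefficients beyond index 2 vanish, the partial sums with at least 3 terms are all
    [a 2 * x ^+ 2]. The exponent found makes [xi'(1) < xi''(1)] strict. *)
Lemma nquad_coef_gt0 (R : realType) (a : R^nat) :
  mixture a -> ~ pure_quadratic a -> exists2 p, (2 < p)%N & 0 < a p.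
Proof.
move=> [a0 a00 a10 _ _] nquad; apply: contrapT => nex; apply: nquad.
have a3 p : (2 < p)%N -> a p = 0.
  move=> p2; apply/eqP; rewrite eq_le a0 andbT leNgt; apply/negP => ap.
  by apply: nex; exists p.
exists (a 2%N) => x _; rewrite /psum; apply: cvg_lim => //.
rewrite -(cvg_shiftn 3) /=; rewrite [X in X @ _](_ : _ = cst (a 2%N * x ^+ 2)).
  exact: cvg_cst.
apply/funext => n; rewrite /pseries /series /= addn3 !big_nat_recl//= a00 a10.
by rewrite big1 ?mul0r ?add0r ?addr0// => i _; rewrite a3 ?mul0r.
Qed.

(** * Passage to the limit in the truncated inequalities *)

Section PowerSeriesLimits.
Context {R : realType} (c : R^nat) (K : R).
Hypotheses (c0 : forall k, 0 <= c k) (c00 : c 0%N = 0).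
Hypotheses (K1 : 1 < K) (cK : cvgn (pseries c K)).

Let psumE N z : pseries c z N = \sum_(k < N) c k * z ^+ k.
Proof. by rewrite /pseries /series /= big_mkord. Qed.

Lemma cvg_psum (z : R) : 0 <= z <= 1 ->
  \sum_(k < N) c k * z ^+ k @[N --> \oo] --> psum c z.
Proof.
move=> /andP[z0 z1].
rewrite (_ : (fun _ => _) = pseries c z); last by apply/funext => N; rewrite psumE.
by apply: (is_cvg_pseries_inside cK);
  rewrite ger0_norm// (le_lt_trans z1)// (lt_le_trans K1)// ler_norm.
Qed.

Lemma cvg_psum_diffs (z : R) : 0 <= z <= 1 ->
  \sum_(k < N) k%:R * c k * z ^+ k.-1 @[N --> \oo] --> psum (pseries_diffs c) z.
Proof.
move=> /andP[z0 z1].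
have : cvgn (pseries (pseries_diffs c) z).
  by apply: (is_cvg_pseries_diffs c0 cK); rewrite z0 (le_lt_trans z1).
rewrite (_ : (fun _ => _) = series (fun k => k%:R * c k * z ^+ k.-1)).
  exact: pseries_diffs_equiv.
by apply/funext => N; rewrite /series /= big_mkord.
Qed.

Lemma cvg_psum1 : \sum_(k < N) c k @[N --> \oo] --> psum c 1.
Proof.
rewrite (_ : (fun _ => _) = fun N => \sum_(k < N) c k * 1 ^+ k).
  by apply: cvg_psum; rewrite ler01 lexx.
apply/funext => N.
by apply: eq_bigr => k _; rewrite expr1n mulr1.
Qed.

Lemma cvg_psum_diffs1 :
  \sum_(k < N) k%:R * c k @[N --> \oo] --> psum (pseries_diffs c) 1.
Proof.
rewrite (_ : (fun _ => _) = fun N => \sum_(k < N) k%:R * c k * 1 ^+ k.-1).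
  by apply: cvg_psum_diffs; rewrite ler01 lexx.
apply/funext => N.
by apply: eq_bigr => k _; rewrite expr1n mulr1.
Qed.

Lemma psum_ge0 (z : R) : 0 <= z <= 1 -> 0 <= psum c z.
Proof.
move=> z01; apply: (cvgr_to_ge (cvg_psum z01)); apply: nearW => N.
by have /andP[z0 _] := z01; apply: sumr_ge0 => k _; rewrite mulr_ge0// exprn_ge0.
Qed.

Lemma psum_diffs_ge0 (z : R) : 0 <= z <= 1 -> 0 <= psum (pseries_diffs c) z.
Proof.
move=> z01; apply: (cvgr_to_ge (cvg_psum_diffs z01)); apply: nearW => N.
have /andP[z0 _] := z01.
by apply: sumr_ge0 => k _; rewrite !mulr_ge0// exprn_ge0.
Qed.

Lemma psum_le_lin (z : R) : 0 <= z <= 1 -> psum c z <= z * psum c 1.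
Proof.
move=> z01; have /andP[z0 z1] := z01.
apply: (ler_cvg_to (cvg_psum z01) (cvgM (cvg_cst z) cvg_psum1)).
apply: nearW => N.
rewrite [leRHS](_ : _ = z * \sum_(k < N) c k)// mulr_sumr; apply: ler_sum => -[[|k] kN] _ /=.
  by rewrite c00 mul0r mulr0.
by rewrite mulrC ler_wpM2r// exprS ler_piMr// exprn_ile1.
Qed.

Lemma psum_chord (z : R) : 0 <= z <= 1 ->
  psum c 1 ^+ 2 - psum c z ^+ 2
    <= psum (pseries_diffs c) 1 * psum c 1 * (1 - z ^+ 2).
Proof.
move=> z01; have /andP[z0 z1] := z01.
have C1 := cvg_psum1; have Cz := cvg_psum z01; have D1 := cvg_psum_diffs1.
apply: (ler_cvg_to (cvgB (cvgM C1 C1) (cvgM Cz Cz))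
                   (cvgM (cvgM D1 C1) (cvg_cst (1 - z ^+ 2)))).
by apply: nearW => N; exact: psum_chord_le.
Qed.

Lemma psum_slope (z : R) : 0 <= z <= 1 ->
  0 <= psum c 1 ^+ 2 - psum c z ^+ 2
    + (psum c 1 + z * psum c z)
      * (psum (pseries_diffs c) 1 - psum (pseries_diffs c) z)
    - psum (pseries_diffs c) 1 * psum (pseries_diffs c) z * (1 - z ^+ 2).
Proof.
move=> z01; have /andP[z0 z1] := z01.
have C1 := cvg_psum1; have Cz := cvg_psum z01.
have D1 := cvg_psum_diffs1; have Dz := cvg_psum_diffs z01.
apply: (cvgr_to_ge (cvgB (cvgD (cvgB (cvgM C1 C1) (cvgM Cz Cz))
  (cvgM (cvgD C1 (cvgM (cvg_cst z) Cz)) (cvgB D1 Dz)))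
  (cvgM (cvgM D1 Dz) (cvg_cst (1 - z ^+ 2))))).
by apply: nearW => N; exact: psum_slope_ge0.
Qed.

(** Strictness survives the limit because the term at [m] alone bounds all long partial sums below
    by [c m]; for the difference, [m * c m - c m >= c m]. *)
Lemma psum_lt_diffs m : (1 < m)%N -> 0 < c m ->
  0 < psum c 1 /\ psum c 1 < psum (pseries_diffs c) 1.
Proof.
move=> m1 cm; have C1 := cvg_psum1; have D1 := cvg_psum_diffs1.
split.
  apply: (lt_le_trans cm); apply: (cvgr_to_ge C1).
  exists m.+1 => // N /= mN.
  by rewrite (bigD1 (Ordinal mN))//= lerDl sumr_ge0.
rewrite -subr_gt0; apply: (lt_le_trans cm); apply: (cvgr_to_ge (cvgB D1 C1)).
exists m.+1 => // N /= mN.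
rewrite [leRHS](_ : _ = \sum_(k < N) (k%:R * c k - c k)); last by rewrite sumrB.
rewrite (bigD1 (Ordinal mN))//=.
have k1 k : 0 <= k%:R * c k - c k.
  case: k => [|k]; first by rewrite c00 mulr0 subr0.
  by rewrite subr_ge0 ler_peMl// ler1n.
apply: ler_wpDr; first exact: sumr_ge0.
have : 2 <= m%:R :> R by rewrite ler_nat.
by move=> /(ler_wpM2r (ltW cm)); lra.
Qed.

End PowerSeriesLimits.

(** * The supremum over overlaps *)

(** Bounds the value at overlap 1, defined as a left limit, without a proof that this limit
    exists. *)
Lemma lim_ereal_le (R : realType) (T : Type) (F : set_system T) (FF : ProperFilter F)
    (f : T -> \bar R) (b : \bar R) :
  (0 <= b)%E -> (\forall t \near F, f t <= b)%E -> (lim (f @ F) <= b)%E.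
Proof.
move=> b0 fb; have [cf|ncf] := pselect (cvg (f @ F)); first exact: lime_le.
(* the junk value of a non-existing limit is [point], here [0] *)
by rewrite /lim /lim_in getPN// => l fl; apply/ncf/cvg_ex; exists l.
Qed.

Theorem theorem3p1 (R : realType) (a : R^nat)
    (a_mixture : mixture a) (a_nquad : ~ pure_quadratic a) (x : R) :
  (0 <= Ifun (psum a) x)%E ->
  ereal_sup [set Sfun (psum a) x al | al in [set al : R | 0 <= al <= 1]]
    = Sfun (psum a) x 0
  /\ Sfun (psum a) x 0 = (2%:E * Ifun (psum a) x)%E.
Proof.
move=> I_ge0.
have [K K1 aK] := mixture_cvg a_mixture.
have [a0 a00 a10 _ _] := a_mixture.
set g := pseries_diffs a; set h := pseries_diffs g.
have zK (z : R) : 0 <= z <= 1 -> `|z| < K.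
  by move=> /andP[z0 z1]; rewrite ger0_norm// (le_lt_trans z1).
have dE (z : R) : 0 <= z <= 1 -> derive1 (psum a) z = psum g z.
  by move=> z01; rewrite derive1E; have [_ ->] := is_derive_psum a0 aK (zK _ z01).
have ddE (z : R) : 0 <= z <= 1 -> derive1n 2 (psum a) z = psum h z.
  by move=> z01; rewrite (derive1n2_psum a0 aK (zK _ z01)).
have I1 : 0 <= (1 : R) <= 1 by rewrite ler01 lexx.
have I0 : 0 <= (0 : R) <= 1 by rewrite ler01 lexx.
pose L := (1 + K) / 2.
have [L1 LK] : 1 < L /\ L < K by rewrite /L; split; lra.
have gL : cvgn (pseries g L) by apply: (is_cvg_pseries_diffs a0 aK); lra.
have g0 k : 0 <= g k by rewrite mulr_ge0.
have g00 : g 0%N = 0 by rewrite /g /pseries_diffs a10 mulr0.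
have [p p2 ap] := nquad_coef_gt0 a_mixture a_nquad.
have [d10 d12] : 0 < psum g 1 /\ psum g 1 < psum h 1.
  (* The coefficient of [xi'] at [p.-1] is [p * a p], and [p > 2] makes this index exceed 1. *)
  apply: (psum_lt_diffs g0 g00 L1 gL (m := p.-1)); first by case: p p2 {ap} => [|[]].
  by case: p p2 ap => // q _ aq; rewrite mulr_gt0.
have d20 := lt_trans d10 d12.
have lin z z01 := psum_le_lin g0 g00 L1 gL (z := z) z01.
have g_ge0 z z01 := psum_ge0 g0 L1 gL (z := z) z01.
have h_ge0 z z01 := psum_diffs_ge0 g0 L1 gL (z := z) z01.
have chord z z01 := psum_chord g0 g00 L1 gL (z := z) z01.
have slope z z01 := psum_slope g0 g00 L1 gL (z := z) z01.
have g_at0 : psum g 0 = 0.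
  by apply/eqP; rewrite eq_le g_ge0// andbT (le_trans (lin _ I0))// mul0r.
have dE1 := dE 1 I1; have ddE1 := ddE 1 I1.
set d1 := psum g 1 in d10 d12 lin chord slope dE1.
set d2 := psum h 1 in d12 d20 chord slope ddE1.
pose Y := x ^+ 2 / (2 * d2).
have Y0 : 0 <= Y by rewrite divr_ge0 ?sqr_ge0// mulr_ge0// ltW.
have d1n : d1 != 0 by rewrite gt_eqF.
have d2n : d2 != 0 by rewrite gt_eqF.
have d12n : d1 + d2 != 0 by rewrite gt_eqF// addr_gt0.
(* [I(x) >= 0] rules out the value [-oo] of [Omega]. *)
have [w Ow w0] : exists2 w, Omega (x / Num.sqrt (2 * d2)) = w%:E & w <= 0.
  move: I_ge0 (Omega_le0 (x / Num.sqrt (2 * d2))); rewrite /Ifun dE1 ddE1.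
  case: (Omega _) => [w|//|/=]; last by rewrite leeNy_eq.
  by rewrite lee_fin => _ w0; exists w.
(* [V] is [S(x, 0)] without its [Omega] contribution; as [w <= 0], it inherits nonnegativity from
   [2 * I(x)]. *)
pose V := ln (d2 / d1) + Y * ((d1 - d2) / (d1 + d2)).
have IE : (2%:E * Ifun (psum a) x = (V + 2 * w)%:E)%E.
  rewrite /Ifun dE1 ddE1 Ow -EFinD -EFinM.
  rewrite [X in X%:E](_ : _ = V + 2 * w)// /V /Y.
  have d21n : d2 + d1 != 0 by rewrite addrC.
  by field; rewrite ?d2n ?d12n ?d21n.
have V_ge0 : 0 <= V + 2 * w.
  by rewrite -lee_fin -IE mule_ge0// lee_fin.
have YB : Y * (d2 - d1) <= ln (d2 / d1) * (d2 + d1).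
  have : 0 <= V by lra.
  rewrite -(@pmulr_lge0 _ (d1 + d2)) ?addr_gt0//.
  rewrite /V mulrDl -[Y * _ * _]mulrA divfK//; lra.
have S0E : Sfun_lt1 (psum a) x 0 = (V + 2 * w)%:E.
  rewrite /Sfun_lt1 /Qfun dE1 ddE1 dE// ddE// g_at0 Ow -EFinM -EFinD.
  congr (_%:E); congr (_ + _); rewrite /V -/Y; congr (_ + Y * _).
    rewrite !expr0n /= !subr0 !mul1r -expr_div_n lnXn ?divr_gt0//; lra.
  rewrite !expr0n /= !(mul0r, subr0, mul1r).
  have t0 := h_ge0 0 I0.
  have dt : d1 + psum h 0 != 0 by rewrite gt_eqF// ltr_wpDr.
  (* At overlap 0 the denominator of [Q] factors, and [d1 + psum h 0] cancels. *)
  rewrite (_ : _ + d2 * psum h 0 = (d1 + d2) * (d1 + psum h 0)); last by ring.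
  by field; rewrite d12n dt.
have S_le al : 0 <= al < 1 -> (Sfun_lt1 (psum a) x al <= (V + 2 * w)%:E)%E.
  move=> /andP[al0 al1]; have al01 : 0 <= al <= 1 by rewrite al0 ltW.
  rewrite /Sfun_lt1 /Qfun dE1 ddE1 dE// ddE// Ow -EFinM -EFinD lee_fin lerD2r.
  apply: complexity_value_le => //; rewrite ?al0//.
  - by rewrite g_ge0// lin.
  - exact: h_ge0.
  - exact: chord.
  - exact: slope.
have S0 : Sfun (psum a) x 0 = (V + 2 * w)%:E by rewrite /Sfun eq_sym oner_eq0.
split; last by rewrite S0 IE.
apply/eqP; rewrite eq_le; apply/andP; split; last first.
  by apply: ereal_sup_ubound; exists 0.
apply: ge_ereal_sup => _ [al /= /andP[al0 al1] <-]; rewrite S0 /Sfun.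
case: eqP => [_|/eqP aln]; last by rewrite S_le// al0 lt_neqAle aln.
apply: lim_ereal_le; first by rewrite lee_fin.
near=> b; apply: S_le; apply/andP; split; last by near: b; exact: nbhs_left_lt.
by near: b; exact: nbhs_left_ge.
Unshelve. all: end_near. Qed.
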